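(* Let $G$ be a finite group. Then the inclusion graph $\mathcal I(G)$ is complete if and only if $G\cong \mathbb Z_{p^\alpha}$ for some prime $p$ and some integer $\alpha>1$. Moreover, for every prime $p$ and integer $\alpha>1$, $\mathcal I(\mathbb Z_{p^\alpha})\cong K_{\alpha-1}$.
   Context: For a finite group $G$, the inclusion graph of subgroups $\mathcal I(G)$ is the simple graph whose vertices are the proper subgroups of $G$, where ''proper'' means different from both the trivial subgroup and $G$ itself; two distinct vertices $H,K$ are adjacent if and only if $H\subset K$ or $K\subset H$. Graphs are understood to have a nonempty vertex set, so $G$ is assumed to have at least one subgroup different from $\{e\}$ and $G$. A graph is complete if any two distinct vertices are adjacent; $K_n$ is the complete graph on $n$ vertices. *)

(* Defs.v *)
From mathcomp Require Import all_boot all_fingroup all_algebra.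

Set Implicit Arguments.
Unset Strict Implicit.
Unset Printing Implicit Defensive.

Record sgraph := SGraph {
  vertex :> finType;
  adj : rel vertex;
  adj_sym : symmetric adj;
  adj_irrefl : irreflexive adj
}.

Definition complete (X : sgraph) : Prop :=
  forall x y : X, x != y -> adj x y.

Definition graph_iso (X Y : sgraph) : Prop :=
  exists2 f : X -> Y, bijective f & forall x y : X, adj (f x) (f y) = adj x y.

Section CompleteGraph.

Variable n : nat.

Definition Kn_adj : rel 'I_n := fun i j => i != j.

Lemma Kn_adj_sym : symmetric Kn_adj.
Proof. by move=> i j; rewrite /Kn_adj eq_sym. Qed.

Lemma Kn_adj_irrefl : irreflexive Kn_adj.
Proof. by move=> i; rewrite /Kn_adj eqxx. Qed.

Definition complete_graph : sgraph := SGraph Kn_adj_sym Kn_adj_irrefl.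

End CompleteGraph.

Section InclusionGraph.

Local Open Scope group_scope.

Variables (gT : finGroupType) (G : {group gT}).

(* Not [H \proper G]: here a proper subgroup must be nontrivial as well. *)
Definition proper_subgroup : pred {group gT} :=
  fun H => [&& H \subset G, H :!=: 1 & H :!=: G].

Definition incl_vertex : finType := {H : {group gT} | proper_subgroup H}.

Definition incl_adj : rel incl_vertex :=
  fun H K => (H != K) &&
    ((val H \subset val K) || (val K \subset val H)).

Lemma incl_adj_sym : symmetric incl_adj.
Proof. by move=> H K; rewrite /incl_adj eq_sym orbC. Qed.

Lemma incl_adj_irrefl : irreflexive incl_adj.
Proof. by move=> H; rewrite /incl_adj eqxx. Qed.

Definition inclusion_graph : sgraph := SGraph incl_adj_sym incl_adj_irrefl.

End InclusionGraph.

(* Main.v *)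
Require Import Defs.
From mathcomp Require Import all_boot all_fingroup all_algebra.
From mathcomp Require Import cyclic pgroup.

Set Implicit Arguments.
Unset Strict Implicit.
Unset Printing Implicit Defensive.

(** Completeness of the inclusion graph says that the proper nontrivial
    subgroups form a chain under inclusion; adding the trivial subgroup and the
    whole group keeps it a chain, so the whole subgroup lattice is totally
    ordered ([complete_incl_comparable]).

    If the lattice is a chain, an element of maximal order generates G, because
    its cyclic subgroup is comparable with that of every other element
    ([comparable_cyclic]).  By Cauchy's theorem, two primes dividing the order
    of G give subgroups of these two orders; being comparable they have the
    same order, so only one prime p occurs ([comparable_prime_power]).  A proper
    nontrivial subgroup then forces the exponent to be at least 2.

    Conversely, in a cyclic group inclusion of subgroups is divisibility of
    their orders, and divisibility is total among powers of a prime
    ([cyclic_prime_power_comparable]).  The proper nontrivial subgroups of a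
    cyclic group of order p ^ a are thus classified by their orders
    p, ..., p ^ (a - 1), and any bijection between complete graphs is an
    isomorphism. *)

Section SubgroupChains.

Local Open Scope group_scope.

Variable gT : finGroupType.
Implicit Types G H K : {group gT}.

Definition comparable_subgroups G :=
  forall H K, H \subset G -> K \subset G -> (H \subset K) || (K \subset H).

Lemma complete_incl_comparable G :
  complete (inclusion_graph G) <-> comparable_subgroups G.
Proof.
split=> [cG H K sHG sKG | cG x y neq_xy]; last first.
  rewrite /= /incl_adj neq_xy /=.
  by have /and3P[sxG _ _] := valP x; have /and3P[syG _ _] := valP y; apply: cG.
have [-> | ntH] := eqVneq (H : {set gT}) 1; first by rewrite sub1G.
have [-> | ntK] := eqVneq (K : {set gT}) 1; first by rewrite sub1G orbT.
have [-> | prH] := eqVneq (H : {set gT}) G; first by rewrite sKG orbT.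
have [-> | prK] := eqVneq (K : {set gT}) G; first by rewrite sHG.
have [<- | neqHK] := eqVneq H K; first by rewrite subxx.
have vH : proper_subgroup G H by rewrite /proper_subgroup sHG ntH prH.
have vK : proper_subgroup G K by rewrite /proper_subgroup sKG ntK prK.
by have /andP[] := cG (Sub H vH) (Sub K vK) neqHK.
Qed.

Lemma comparable_cyclic G : comparable_subgroups G -> cyclic G.
Proof.
move=> cG; have [x Gx max_x] := @arg_maxnP _ 1 [in G] (fun x => #[x]) (group1 G).
rewrite /= in Gx max_x.
apply/cyclicP; exists x; apply/eqP; rewrite eqEsubset cycle_subG Gx andbT.
apply/subsetP=> y Gy; rewrite -cycle_subG.
have /orP[sxy | //] : (<[x]> \subset <[y]>) || (<[y]> \subset <[x]>).
  by apply: cG; rewrite cycle_subG.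
(* the order of x being maximal, an inclusion the wrong way is an equality *)
have /eqP <- : <[x]> == <[y]> by rewrite eqEcard sxy; apply: max_x.
by [].
Qed.

Lemma comparable_prime_power G :
    G :!=: 1 -> comparable_subgroups G ->
  exists2 p : nat, prime p & exists a, #|G| = (p ^ a)%N.
Proof.
move=> ntG cG; set p := pdiv #|G|.
have p_pr : prime p by rewrite pdiv_prime ?cardG_gt1.
exists p => //; suff pG : p.-group G.
  by exists (logn p #|G|); rewrite -{1}(card_pgroup pG).
apply/pgroupP=> q q_pr /(Cauchy q_pr)[y Gy oy].
have [x Gx ox] := Cauchy p_pr (pdiv_dvd #|G|).
(* comparable subgroups have orders dividing one another *)
have : (<[x]> \subset <[y]>) || (<[y]> \subset <[x]>).
  by apply: cG; rewrite cycle_subG.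
by case/orP=> /cardSg; rewrite -!orderE ox oy dvdn_prime2 // eq_sym.
Qed.

Lemma cyclic_prime_power_comparable G p a :
  prime p -> cyclic G -> #|G| = (p ^ a)%N -> comparable_subgroups G.
Proof.
move=> p_pr cycG oG H K sHG sKG.
rewrite -(cardSg_cyclic cycG sHG sKG) -(cardSg_cyclic cycG sKG sHG).
have := cardSg sHG; rewrite oG => /(dvdn_pfactor _ _ p_pr)[i _ ->].
have := cardSg sKG; rewrite oG => /(dvdn_pfactor _ _ p_pr)[j _ ->].
by have [/(dvdn_exp2l p) -> | /ltnW/(dvdn_exp2l p) ->] := leqP i j;
  rewrite ?orbT.
Qed.

Lemma proper_subgroup_exponent_gt1 G p a :
    prime p -> #|G| = (p ^ a)%N -> (exists H, proper_subgroup G H) ->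
  (1 < a)%N.
Proof.
move=> p_pr oG [H /and3P[sHG ntH prH]].
have ltHG : (#|H| < #|G|)%N by rewrite proper_card // properEneq prH.
have := cardSg sHG; rewrite oG => /(dvdn_pfactor _ _ p_pr)[i _ oH].
rewrite -cardG_gt1 oH in ntH; rewrite oG oH ltn_exp2l ?prime_gt1 // in ltHG.
by case: i ntH ltHG {oH} => // i _; apply: leq_ltn_trans.
Qed.

(** The position of a subgroup in the chain is the exponent of its order,
    shifted by one because the chain starts at order p; the subgroup at a given
    position is generated by a suitable power of a generator. *)
Lemma incl_graph_cyclic_prime_power G p a :
    prime p -> cyclic G -> #|G| = (p ^ a)%N ->
  graph_iso (inclusion_graph G) (complete_graph (a - 1)).
Proof.
move=> p_pr cycG oG.
have p_gt1 := prime_gt1 p_pr.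
have cG := cyclic_prime_power_comparable p_pr cycG oG.
have level_exists (x : inclusion_graph G) :
    exists i : 'I_(a - 1), #|val x| == (p ^ i.+1)%N.
  have /and3P[sxG ntx prx] := valP x.
  have := cardSg sxG; rewrite oG => /(dvdn_pfactor _ _ p_pr)[i _ ox].
  have : (#|val x| < #|G|)%N by rewrite proper_card // properEneq prx.
  rewrite oG ox ltn_exp2l //; rewrite -cardG_gt1 ox in ntx.
  case: i ntx ox => // i _ ox lt_ia.
  have lt_i : (i < a - 1)%N by rewrite ltn_subRL.
  by exists (Ordinal lt_i); rewrite eqxx.
pose level x := xchoose (level_exists x).
have levelP (x : inclusion_graph G) : #|val x| = (p ^ (level x).+1)%N.
  exact/eqP/(xchooseP (level_exists x)).
have level_inj : injective level.
  move=> x y eq_xy; apply/val_inj/val_inj/eqP => /=.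
  have /and3P[sxG _ _] := valP x; have /and3P[syG _ _] := valP y.
  by rewrite (eq_subG_cyclic cycG) // !levelP eq_xy.
have [z defG] := cyclicP cycG.
have oz : #[z] = (p ^ a)%N by rewrite orderE -defG.
have oH (i : 'I_(a - 1)) : #[z ^+ (p ^ (a - i.+1))] = (p ^ i.+1)%N.
  have lt_ia : (i.+1 <= a)%N
    by have := ltn_ord i; rewrite ltn_subRL; apply: ltnW.
  rewrite orderXdiv oz ?dvdn_exp2l ?leq_subr //.
  by rewrite -expnB ?prime_gt0 ?leq_subr // subKn.
have vH (i : 'I_(a - 1)) :
    proper_subgroup G <[z ^+ (p ^ (a - i.+1))]>%G.
  rewrite /proper_subgroup cycle_subG defG mem_cycle /=.
  rewrite -cardG_gt1 -orderE oH -{1}(expn0 p) ltn_exp2l //=.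
  apply/eqP=> eqHG; have := oH i; rewrite orderE eqHG -orderE oz.
  move/eqP; rewrite eqn_exp2l // => /eqP a_i.
  by have := ltn_ord i; rewrite ltn_subRL add1n -a_i ltnn.
pose subgroup_at i : inclusion_graph G := Sub _ (vH i).
have subgroup_atK : cancel subgroup_at level.
  move=> i; apply/val_inj/eqP; rewrite -eqSS -(eqn_exp2l _ _ p_gt1).
  by rewrite -levelP /= -orderE oH.
exists level; first by exists subgroup_at => //; apply: inj_can_sym.
move=> x y; rewrite /= /Kn_adj (inj_eq level_inj).
have [-> | neq_xy] := eqVneq x y; first by rewrite incl_adj_irrefl.
by have /complete_incl_comparable := cG; move/(_ x y neq_xy).
Qed.

End SubgroupChains.

Theorem theorem2p4 :
  (forall (gT : finGroupType) (G : {group gT}),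
     (exists H : {group gT}, proper_subgroup G H) ->
     complete (inclusion_graph G) <->
     exists p a : nat,
       [/\ prime p, 1 < a & isog G [set: 'Z_(p ^ a)]]) /\
  (forall p a : nat, prime p -> 1 < a ->
     graph_iso (inclusion_graph [set: 'Z_(p ^ a)]%G) (complete_graph (a - 1))).
Proof.
have cycZ n : cyclic [set: 'Z_n] by rewrite Zp_cycle cycle_cyclic.
have pa_gt1 p a : prime p -> 1 < a -> 1 < p ^ a.
  by move=> p_pr a_gt1; rewrite -(exp1n a) ltn_exp2r ?prime_gt1 // ltnW.
have cardZ n : 1 < n -> #|[set: 'Z_n]| = n.
  by move=> n_gt1; rewrite cardsT card_ord Zp_cast.
split=> [gT G exH | p a p_pr a_gt1]; last first.
  apply: (incl_graph_cyclic_prime_power p_pr); first exact: cycZ.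
  by rewrite cardZ ?pa_gt1.
split=> [/complete_incl_comparable cG | [p [a [p_pr a_gt1 isoG]]]].
  have ntG : G :!=: 1%g.
    have [H /and3P[sHG ntH _]] := exH; apply: contraNneq ntH => G1.
    by rewrite -subG1 -G1.
  have [p p_pr [a oG]] := comparable_prime_power ntG cG.
  have a_gt1 := proper_subgroup_exponent_gt1 p_pr oG exH.
  exists p, a; split=> //.
  rewrite isog_cyclic_card ?(comparable_cyclic cG) ?cycZ //=.
  by rewrite oG cardZ ?pa_gt1.
apply/complete_incl_comparable/(cyclic_prime_power_comparable p_pr (a := a)).
  by rewrite (isog_cyclic isoG).
by rewrite (card_isog isoG) cardZ ?pa_gt1.
Qed.
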